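(* Let $d$ be a positive integer and let $X=\{X_k:k\in\mathbb{Z}^d\}$ be a centered, complex-valued, weakly stationary random field such that $\varrho'(X,n)\to 0$ as $n\to\infty$, and let $f$ denote its (continuous) spectral density, writing $f(\lambda):=f(e^{i\lambda})$. Let $\{v^{(n)}\}_{n=1}^\infty$ be a sequence of vectors in $\mathbb{N}^d$ with $\lim_{n\to\infty}\min\{v^{(n)}_1,\dots,v^{(n)}_d\}=\infty$. Then \[\lim_{n\to\infty} E\, I_n^{(\lambda)}=f(\lambda)\quad\text{for all }\lambda\in(-\pi,\pi]^d,\] and this convergence is uniform over all $\lambda\in(-\pi,\pi]^d$.
   Context: A random field $X=\{X_k:k\in\mathbb{Z}^d\}$ is a collection of complex random variables indexed by $\mathbb{Z}^d$; it is centered if $EX_k=0$ for all $k$. It is weakly stationary if $E|X_k|^2=\sigma^2<\infty$ for all $k$, $EX_k$ is constant, and $E(X_k-\mu)\overline{(X_j-\mu)}$ depends only on $k-j$. For $\sigma$-fields $\mathcal A,\mathcal B$, $\varrho(\mathcal A,\mathcal B)=\sup \mathrm{Corr}(f,g)$ over real $f\in L^2(\mathcal A)$, $g\in L^2(\mathcal B)$. For $n\ge1$, $\varrho'(X,n)=\sup_{S,T}\varrho(\sigma(X_k:k\in S),\sigma(X_k:k\in T))$, the supremum over finite nonempty $S,T\subset\mathbb{Z}^d$ for which there is a coordinate $u\in\{1,\dots,d\}$ with $|k_u-l_u|\ge n$ for all $k\in S$, $l\in T$ (the sets may be interlaced). A nonnegative Borel function $f$ on the torus $\mathbb{T}^d$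 is the spectral density of $X$ if $EX_k\overline{X_j}=\int_{\mathbb{T}^d}e^{i(k-j)\cdot\theta}f(e^{i\theta})\,dm^d(e^{i\theta})$, where $m^d$ is normalized Lebesgue (Haar) measure on $\mathbb{T}^d$; such fields with $\varrho'(X,n)\to0$ have a continuous spectral density. For $\lambda\in(-\pi,\pi]^d$, $X_k^{(\lambda)}:=e^{-ik\cdot\lambda}X_k$. For $v\in\mathbb{N}^d$, the box $\mathfrak B(v)=\{w\in\mathbb{N}^d:1\le w_j\le v_j,\ j=1,\dots,d\}$; $\mathfrak B_n:=\mathfrak B(v^{(n)})$, $V^{(n)}:=\prod_{j=1}^d v_j^{(n)}$, $S_n^{(\lambda)}:=\sum_{k\in\mathfrak B_n}X_k^{(\lambda)}$, and the periodogram is $I_n^{(\lambda)}:=|S_n^{(\lambda)}|^2/V^{(n)}$. *)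

(* Defs.v *)
From HB Require Import structures.
From mathcomp Require Import all_boot all_order all_algebra.
From mathcomp Require Import all_classical all_reals all_analysis.
From mathcomp Require Import complex.
Set Implicit Arguments. Unset Strict Implicit. Unset Printing Implicit Defensive.
Import Order.TTheory GRing.Theory Num.Theory.
Import numFieldNormedType.Exports.
Local Open Scope classical_set_scope.
Local Open Scope ring_scope.

Definition Zd (d : nat) := {ffun 'I_d -> int}.

Definition dotZ (R : realType) (d : nat) (k : Zd d) (lam : 'rV[R]_d) : R :=
  \sum_(j < d) (k j)%:~R * lam ord0 j.

Definition expi (R : realType) (t : R) : R[i] := (cos t +i* sin t)%C.

Definition sqmod (R : realType) (z : R[i]) : R := complex.Re z ^+ 2 + complex.Im z ^+ 2.

Definition in_cube (R : realType) (d : nat) (lam : 'rV[R]_d) : Prop :=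
  forall j : 'I_d, - pi < lam ord0 j <= pi.

Section Probabilistic.
Context (R : realType) (dT : measure_display) (T : measurableType dT)
  (P : probability T R).

Definition Ex (f : T -> R) : R := fine ('E_P[f])%E.

Definition cEx (Z : T -> R[i]) : R[i] :=
  (Ex (fun w => complex.Re (Z w)) +i* Ex (fun w => complex.Im (Z w)))%C.

Definition L2 (f : T -> R) : Prop :=
  measurable_fun setT f /\ P.-integrable setT (fun w => ((f w) ^+ 2)%:E).

Definition variance_ (f : T -> R) : R := Ex (fun w => f w ^+ 2) - (Ex f) ^+ 2.
Definition covariance_ (f g : T -> R) : R :=
  Ex (fun w => f w * g w) - Ex f * Ex g.
Definition corr (f g : T -> R) : R :=
  covariance_ f g / Num.sqrt (variance_ f * variance_ g).

Definition measurable_wrt (A : set (set T)) (f : T -> R) : Prop :=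
  forall B : set R, measurable B -> A (f @^-1` B).

(** rho(A, B) = sup Corr(f, g), f in L^2(A), g in L^2(B) real
    (with non-degenerate variances so that Corr is defined) *)
Definition rho (A B : set (set T)) : R :=
  sup [set r | exists f g : T -> R,
         [/\ L2 f /\ L2 g, measurable_wrt A f /\ measurable_wrt B g,
             0 < variance_ f, 0 < variance_ g & r = corr f g]].

Context (d : nat).

(** sigma(X_k : k in S): generated by the preimages of Borel sets under
    the real and imaginary parts of X_k (equivalently, of Borel sets of C
    under X_k), k in S. *)
Definition sigmaX (X : Zd d -> T -> R[i]) (S : set (Zd d)) : set (set T) :=
  <<s [set A | exists k, S k /\ exists B : set R, measurable B /\
        (A = (fun w => complex.Re (X k w)) @^-1` B \/
         A = (fun w => complex.Im (X k w)) @^-1` B)] >>.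

Definition separated (n : nat) (S S' : set (Zd d)) : Prop :=
  exists u : 'I_d, forall k l, S k -> S' l -> (n <= `|k u - l u|)%N.

Definition rho' (X : Zd d -> T -> R[i]) (n : nat) : R :=
  sup [set r | exists S S' : set (Zd d),
         [/\ finite_set S /\ S !=set0, finite_set S' /\ S' !=set0,
             separated n S S' & r = rho (sigmaX X S) (sigmaX X S')]].

Definition centered_weakly_stationary (X : Zd d -> T -> R[i]) : Prop :=
  [/\ (forall k, L2 (fun w => complex.Re (X k w)) /\ L2 (fun w => complex.Im (X k w))),
      (forall k, cEx (X k) = 0),
      (exists sigma2 : R, forall k, Ex (fun w => sqmod (X k w)) = sigma2) &
      (exists r : Zd d -> R[i], forall k j,
          cEx (fun w => X k w * conjc (X j w)) = r (k - j))].

Definition box_pt (v : 'I_d -> nat) (w : {dffun forall j : 'I_d, 'I_(v j)})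
  : Zd d := [ffun j => ((w j).+1)%:Z].

Definition Ssum (X : Zd d -> T -> R[i]) (v : 'I_d -> nat) (lam : 'rV[R]_d)
  (om : T) : R[i] :=
  \sum_(w : {dffun forall j : 'I_d, 'I_(v j)})
     expi (- dotZ (box_pt w) lam) * X (box_pt w) om.

Definition periodogram (X : Zd d -> T -> R[i]) (v : 'I_d -> nat)
  (lam : 'rV[R]_d) (om : T) : R :=
  sqmod (Ssum X v lam om) / (\prod_(j < d) v j)%:R.

End Probabilistic.

(** Normalized Haar integral over the torus T^d, parametrized by
    theta in (-pi, pi]^d, computed as the iterated integral
    (2 pi)^{-d} int ... int g(theta) dtheta_1 ... dtheta_d. *)
Definition upd (R : realType) (d : nat) (th : 'rV[R]_d) (j : 'I_d) (t : R)
  : 'rV[R]_d := \row_(i < d) (if i == j then t else th ord0 i).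

Definition torus_int (R : realType) (d : nat) (g : 'rV[R]_d -> R) : R :=
  foldr (fun (j : 'I_d) (G : 'rV[R]_d -> R) (th : 'rV[R]_d) =>
           (2 * pi)^-1 * Rintegral lebesgue_measure `]- pi, pi]
                          (fun t => G (upd th j t)))
        g (enum 'I_d) 0.

(** f (as a function of lambda, i.e. f(e^{i lambda})) is the spectral
    density of X *)
Definition spectral_density (R : realType) (dT : measure_display)
  (T : measurableType dT) (P : probability T R) (d : nat)
  (X : Zd d -> T -> R[i]) (f : 'rV[R]_d -> R) : Prop :=
  [/\ (forall th, 0 <= f th),
      (forall th (j : 'I_d), f (upd th j (th ord0 j + 2 * pi)) = f th) &
      (forall k j : Zd d,
          cEx P (fun w => X k w * conjc (X j w)) =
          (torus_int (fun th => cos (dotZ (k - j) th) * f th) +i*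
           torus_int (fun th => sin (dotZ (k - j) th) * f th))%C)].

(* Main.v *)
Require Import Defs.
From HB Require Import structures.
From mathcomp Require Import all_boot all_order all_algebra.
From mathcomp Require Import all_classical all_reals all_analysis.
From mathcomp Require Import complex measurable_realfun ring lra.
Import Order.TTheory GRing.Theory Num.Theory.
Import numFieldNormedType.Exports.
Local Open Scope classical_set_scope.
Local Open Scope ring_scope.
Set Implicit Arguments.
Unset Strict Implicit.
Unset Printing Implicit Defensive.

(** Substituting the spectral representation of the covariances, [E I_n] is the
    torus mean of [f] against the product of the Fejer kernels
    [F_N x = |sum_{k=1}^N exp (i k x)|^2 / N] centred at [lam], with [N] the sides
    of the box.  Convergence follows as in Korovkin's theorem: the kernel is
    nonnegative, its mean is [1], and [F_N x * (1 - cos x) <= 2 / N].  By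
    compactness and periodicity, for every [e > 0] there is a [C] with
    [|f th - f lam| <= e + C * sum_j (1 - cos (th_j - lam_j))] on the whole cube,
    so [|E I_n - f lam| <= e + C * sum_j 2 / v_j], uniformly in [lam]. *)

(** * Mean over the circle *)

Lemma Rintegral_sum d (T : measurableType d) (R : realType)
    (mu : {measure set T -> \bar R}) (D : set T) (I : Type) (r : seq I)
    (F : I -> T -> R) : measurable D ->
  (forall i, mu.-integrable D (EFin \o F i)) ->
  (\int[mu]_(x in D) (\sum_(i <- r) F i x) = \sum_(i <- r) \int[mu]_(x in D) F i x)%R.
Proof.
move=> mD iF; rewrite /Rintegral.
under eq_integral do rewrite -sumEFin.
rewrite integral_sum// sum_fine// => i _.
exact: (integrable_fin_num mD (iF i)).
Qed.

Lemma continuous_funD (T : topologicalType) (R : realType) (f g : T -> R) :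
  continuous f -> continuous g -> continuous (fun x => f x + g x).
Proof. by move=> cf cg x; apply: cvgD; [exact: cf|exact: cg]. Qed.

Lemma continuous_funM (T : topologicalType) (R : realType) (f g : T -> R) :
  continuous f -> continuous g -> continuous (fun x => f x * g x).
Proof. by move=> cf cg x; apply: cvgM; [exact: cf|exact: cg]. Qed.

Lemma continuous_sum (T : topologicalType) (R : realType) (I : Type) (r : seq I)
    (F : I -> T -> R) : (forall i, continuous (F i)) ->
  continuous (fun x => \sum_(i <- r) F i x).
Proof.
move=> cF; elim: r => [|i r IH].
  by under eq_fun do rewrite big_nil; move=> x; exact: cvg_cst.
under eq_fun do rewrite big_cons.
exact: continuous_funD.
Qed.

Lemma continuous_prod (T : topologicalType) (R : realType) (I : Type) (r : seq I)
    (F : I -> T -> R) : (forall i, continuous (F i)) ->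
  continuous (fun x => \prod_(i <- r) F i x).
Proof.
move=> cF; elim: r => [|i r IH].
  by under eq_fun do rewrite big_nil; move=> x; exact: cvg_cst.
under eq_fun do rewrite big_cons.
exact: continuous_funM.
Qed.

Section CircleMean.
Context {R : realType}.
Implicit Types g h : R -> R.
Local Notation mu := (@lebesgue_measure R).

(** One layer of the iterated integral in [torus_int], kept in the same form so that [torus_intE]
    holds by conversion. *)
Definition circle_mean g : R :=
  (2 * pi)^-1 * Rintegral mu `]- pi, pi] g.

Lemma pi2_gt0 : 0 < 2 * pi :> R.
Proof. by rewrite mulr_gt0// pi_gt0. Qed.

Lemma continuous_integrable_pi g : continuous g ->
  mu.-integrable `]- pi, pi] (EFin \o g).
Proof.
move=> cg; apply: (@integrableS _ _ _ mu `[- pi, pi]) => //.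
  exact: subset_itv_oc_cc.
apply: continuous_compact_integrable; first exact: segment_compact.
exact: continuous_subspaceT.
Qed.

Lemma circle_mean_cst (c : R) : circle_mean (fun=> c) = c.
Proof.
rewrite /circle_mean Rintegral_cst//= lebesgue_measure_itv/= lte_fin.
rewrite (lt_trans _ (pi_gt0 R)) ?oppr_lt0 ?pi_gt0//= opprK.
by move: (gt_eqF (pi_gt0 R)); move: pi => p p0; field; rewrite p0.
Qed.

Lemma circle_mean_sum (I : Type) (r : seq I) (F : I -> R -> R) :
  (forall i, continuous (F i)) ->
  circle_mean (fun t => \sum_(i <- r) F i t) = \sum_(i <- r) circle_mean (F i).
Proof.
move=> cF; rewrite /circle_mean Rintegral_sum ?mulr_sumr//.
by move=> i; exact: continuous_integrable_pi.
Qed.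

Lemma circle_meanZ (a : R) g : continuous g ->
  circle_mean (fun t => a * g t) = a * circle_mean g.
Proof.
move=> cg; rewrite /circle_mean RintegralZl; first exact: mulrCA.
all: first [exact: measurable_itv|exact: continuous_integrable_pi].
Qed.

Lemma circle_meanD g h : continuous g -> continuous h ->
  circle_mean (fun t => g t + h t) = circle_mean g + circle_mean h.
Proof.
move=> cg ch; rewrite /circle_mean RintegralD; first exact: mulrDr.
all: first [exact: measurable_itv|exact: continuous_integrable_pi].
Qed.

Lemma le_circle_mean g h : continuous g -> continuous h ->
  (forall t, - pi < t <= pi -> g t <= h t) -> circle_mean g <= circle_mean h.
Proof.
move=> cg ch gh; rewrite /circle_mean ler_pM2l ?invr_gt0 ?pi2_gt0//.
by apply: le_Rintegral => //; exact: continuous_integrable_pi.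
Qed.

Lemma circle_mean_near g h (e : R) : continuous g -> continuous h ->
  (forall t, - pi < t <= pi -> `|g t - h t| <= e) ->
  `|circle_mean g - circle_mean h| <= e.
Proof.
move=> cg ch gh; rewrite ler_distl; apply/andP; split.
  (* The constant [e] is its own mean, so both bounds reduce to monotonicity of the mean. *)
  rewrite lerBlDr -[X in _ + X]circle_mean_cst -circle_meanD//; last first.
    exact: cst_continuous.
  apply: le_circle_mean => //.
    by apply: continuous_funD => //; exact: cst_continuous.
  by move=> t /gh; rewrite ler_distl => /andP[]; rewrite lerBlDr.
rewrite -[X in _ + X]circle_mean_cst -circle_meanD//; last first.
  exact: cst_continuous.
apply: le_circle_mean => //.
  by apply: continuous_funD => //; exact: cst_continuous.
by move=> t /gh; rewrite ler_distl => /andP[].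
Qed.

Lemma continuous_cos_affine (m lam : R) : continuous (fun t : R => cos (m * (t - lam))).
Proof.
move=> t; apply: continuous_comp; last exact: continuous_cos.
apply: cvgM; first exact: cvg_cst.
by apply: cvgB; [exact: cvg_id|exact: cvg_cst].
Qed.

Lemma sin_periodic_int (m : int) (x : R) : sin (x + m%:~R * (2 * pi)) = sin x.
Proof.
have nat_case (n : nat) (y : R) : sin (y + n%:R * (2 * pi)) = sin y.
  have -> : n%:R * (2 * pi) = pi *+ 2 *+ n :> R by rewrite !mulr_natl.
  by rewrite (periodicn (@sinD2pi R)).
case: m => n; first exact: nat_case.
(* For a negative multiple, the natural case is applied at the point already shifted back. *)
by rewrite NegzE mulrNz mulNr -[in RHS](subrK (n.+1%:R * (2 * pi)) x) nat_case.
Qed.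

Lemma cos_periodic_int (m : int) (x : R) : cos (x + m%:~R * (2 * pi)) = cos x.
Proof.
have nat_case (n : nat) (y : R) : cos (y + n%:R * (2 * pi)) = cos y.
  have -> : n%:R * (2 * pi) = pi *+ 2 *+ n :> R by rewrite !mulr_natl.
  by rewrite (periodicn (@cosD2pi R)).
case: m => n; first exact: nat_case.
by rewrite NegzE mulrNz mulNr -[in RHS](subrK (n.+1%:R * (2 * pi)) x) nat_case.
Qed.

(** Orthogonality of characters: for [m != 0] the antiderivative [sin (m (t - lam)) / m] takes the
    same value at [- pi] and [pi], since [m] is an integer. *)
Lemma circle_mean_cos (m : int) (lam : R) :
  circle_mean (fun t => cos (m%:~R * (t - lam))) = (m == 0)%:R.
Proof.
have [->|m0] := eqVneq m 0.
  under [X in circle_mean X]eq_fun do rewrite mul0r cos0.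
  exact: circle_mean_cst.
have mR0 : m%:~R != 0 :> R by rewrite intr_eq0.
pose F (t : R) : R := (m%:~R)^-1 * sin (m%:~R * (t - lam)).
have dF (t : R) : is_derive t 1 F (cos (m%:~R * (t - lam))).
  rewrite /F; apply: is_derive_eq.
  rewrite /GRing.scale/=.
  move: (cos _) => c.
  by field.
have ipi : - pi < pi :> R by rewrite (lt_trans _ (pi_gt0 R))// oppr_lt0 pi_gt0.
(* Closing the interval at [- pi] does not change the integral and puts it in the form required by
   the fundamental theorem of calculus. *)
rewrite /circle_mean Rintegral_itv_obnd_cbnd; last first.
  by apply: continuous_integrable_pi; exact: continuous_cos_affine.
rewrite /Rintegral (@continuous_FTC2 _ _ F)//.
- rewrite -EFinB /= /F.
  have -> : m%:~R * (pi - lam) = m%:~R * (- pi - lam) + m%:~R * (2 * pi) :> R by ring.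
  by rewrite sin_periodic_int subrr mulr0.
- by apply: continuous_subspaceT; exact: continuous_cos_affine.
- have cF (t : R) : {for t, continuous F}.
    exact/differentiable_continuous/derivable1_diffP.
  split.
  + by move=> t _; exact: ex_derive.
  + exact/cvg_at_right_filter/cF.
  + exact/cvg_at_left_filter/cF.
- by move=> t _; rewrite derive1E derive_val.
Qed.

End CircleMean.

(** * Iterated mean over the torus *)

Lemma continuous_near (T : topologicalType) (R : realType) (g : T -> R) (x : T) (e : R) :
  continuous g -> 0 < e -> \forall y \near x, `|g x - g y| < e.
Proof.
by move=> /(_ x)/(@cvgrPdist_lt _ _ _ (nbhs x) (nbhs_filter x)) + e0; apply.
Qed.

Section TorusMean.
Context {R : realType} {d : nat}.
Implicit Types (th lam : 'rV[R]_d) (g h : 'rV[R]_d -> R) (s : seq 'I_d).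

(** Averaging over an arbitrary list of coordinates allows induction on the list; coordinates
    outside it are read from the base point. *)
Definition torus_mean s g : 'rV[R]_d -> R :=
  foldr (fun j (G : 'rV[R]_d -> R) th => circle_mean (fun t => G (upd th j t))) g s.

Lemma continuous_rV (T : topologicalType) (F : T -> 'rV[R]_d) :
  (forall j, continuous (fun x => F x ord0 j)) -> continuous F.
Proof.
move=> cF x A [B nB sB]; apply: (filterS (fun y => sB (F y))).
apply: filter_forall => i; apply: filter_forall => j.
by move: (nB i j); rewrite (ord1 i) => nBj; exact: (cF j x _ nBj).
Qed.

Lemma continuous_upd (j : 'I_d) :
  continuous (fun p : 'rV[R]_d * R => upd p.1 j p.2).
Proof.
apply: continuous_rV => i; rewrite /upd.
under eq_fun do rewrite mxE.
case: eqVneq => _ [th t].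
  exact: cvg_snd.
apply: (@continuous_comp _ _ _ fst (fun M : 'rV[R]_d => M ord0 i));
  [exact: cvg_fst|exact: coord_continuous].
Qed.

Lemma continuous_upd_slice g j th : continuous g ->
  continuous (fun t => g (upd th j t)).
Proof.
move=> cg t; apply: continuous_comp; last exact: cg.
apply: continuous_rV => i; rewrite /upd.
under eq_fun do rewrite mxE.
by case: eqVneq => _ x; [exact: cvg_id|exact: cvg_cst].
Qed.

(** A tube argument: by compactness of [[- pi, pi]], for [x] near [th] the slices of [g] through [x]
    and [th] are uniformly close in [t], hence so are their means. It keeps every partial mean
    continuous, thus integrable in the next coordinate. *)
Lemma continuous_circle_mean_upd g j : continuous g ->
  continuous (fun th => circle_mean (fun t => g (upd th j t))).
Proof.
move=> cg th; apply/(@cvgrPdist_le _ _ _ (nbhs th) (nbhs_filter th)) => e e0.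
have /compact_near_coveringP cover : compact `[- pi, pi : R] by exact: segment_compact.
have e20 : 0 < e / 2 by rewrite divr_gt0.
have cG : continuous (fun p : 'rV[R]_d * R => g (upd p.1 j p.2)).
  by move=> p; apply: continuous_comp; [exact: (@continuous_upd j p)|exact: cg].
have := cover _ (nbhs th)
  (fun x t => `|g (upd th j t) - g (upd x j t)| <= e) _.
have prem (t : R) : `[- pi, pi]%classic t -> \forall t' \near t & x \near th,
    `|g (upd th j t') - g (upd x j t')| <= e.
  move=> _.
  (* Both values at [t'] are compared with the value at the centre [(th, t)], each at a cost of
     [e / 2]. *)
  have H1 : \forall t' \near t, `|g (upd th j t) - g (upd th j t')| < e / 2.
    by apply: (@continuous_near _ _ (fun t => g (upd th j t))) => //; exact: continuous_upd_slice.
  have H2 : \forall p \near (th, t), `|g (upd th j t) - g (upd p.1 j p.2)| < e / 2.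
    exact: (continuous_near (th, t) cG e20).
  case: H2 => -[A B] /= [nA nB] AB.
  exists ([set t' | B t' /\ `|g (upd th j t) - g (upd th j t')| < e / 2], A) => /=.
    by split => //; exact: filterI.
  move=> [t' x] /= [[Bt' tt'] Ax].
  have /= xt' := AB (x, t') (conj Ax Bt').
  rewrite (le_trans (ler_distD (g (upd th j t)) _ _))//.
  by rewrite [e]splitr lerD// ltW// distrC.
move=> /(_ _ prem); apply: filterS => x Hx.
apply: circle_mean_near; try exact: continuous_upd_slice.
move=> t /andP[t1 t2]; apply: Hx => /=.
by rewrite in_itv/= (ltW t1) t2.
Qed.

Lemma continuous_torus_mean s g : continuous g -> continuous (torus_mean s g).
Proof. by move=> cg; elim: s => //= j s IH; exact: continuous_circle_mean_upd. Qed.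

Lemma torus_mean_sum s (I : Type) (r : seq I) (F : I -> 'rV[R]_d -> R) th :
  (forall i, continuous (F i)) ->
  torus_mean s (fun x => \sum_(i <- r) F i x) th = \sum_(i <- r) torus_mean s (F i) th.
Proof.
move=> cF; elim: s th => //= j s IH th.
under [X in circle_mean X]eq_fun do rewrite IH.
rewrite circle_mean_sum// => i.
by apply: continuous_upd_slice; exact: continuous_torus_mean.
Qed.

Lemma torus_meanZ s (a : R) g th : continuous g ->
  torus_mean s (fun x => a * g x) th = a * torus_mean s g th.
Proof.
move=> cg; elim: s th => //= j s IH th.
under [X in circle_mean X]eq_fun do rewrite IH.
rewrite circle_meanZ//.
by apply: continuous_upd_slice; exact: continuous_torus_mean.
Qed.

Lemma torus_meanD s g h th : continuous g -> continuous h ->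
  torus_mean s (fun x => g x + h x) th = torus_mean s g th + torus_mean s h th.
Proof.
move=> cg ch; elim: s th => //= j s IH th.
under [X in circle_mean X]eq_fun do rewrite IH.
by rewrite circle_meanD//; apply: continuous_upd_slice; exact: continuous_torus_mean.
Qed.

(** The inequality is only assumed on the cube, so the base point must lie there too; replacing
    coordinates by points of []- pi, pi]] stays inside. *)
Lemma le_torus_mean s g h th : continuous g -> continuous h ->
  (forall x, in_cube x -> g x <= h x) ->
  in_cube th -> torus_mean s g th <= torus_mean s h th.
Proof.
move=> cg ch gh; elim: s th => [|j s IH] th cth /=; first exact: gh.
apply: le_circle_mean => [||t t_pi].
- by apply: continuous_upd_slice; exact: continuous_torus_mean.
- by apply: continuous_upd_slice; exact: continuous_torus_mean.
- by apply: IH => i; rewrite mxE; case: eqP => _.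
Qed.

(** Averaging over a fresh coordinate [a] only affects the factor of index [a]; the rest is a
    constant that leaves the integral. *)
Lemma torus_mean_prod s (g : 'I_d -> R -> R) th :
  uniq s -> (forall j, continuous (g j)) ->
  torus_mean s (fun x => \prod_j g j (x ord0 j)) th =
  \prod_j (if j \in s then circle_mean (g j) else g j (th ord0 j)).
Proof.
move=> + cg; elim: s th => [|a s IH] th //= /andP[a_s us].
under [X in circle_mean X]eq_fun => t.
  rewrite IH// (bigD1 a)//= (negbTE a_s) mxE eqxx mulrC.
  under eq_bigr => j ja do rewrite mxE (negbTE ja).
  over.
rewrite circle_meanZ// [RHS](bigD1 a)//= inE eqxx/= mulrC; congr (_ * _).
by apply: eq_bigr => j ja; rewrite inE (negbTE ja).
Qed.

End TorusMean.

Lemma torus_intE (R : realType) (d : nat) (g : 'rV[R]_d -> R) :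
  torus_int g = torus_mean (enum 'I_d) g 0.
Proof. by []. Qed.

Lemma in_cube0 (R : realType) (d : nat) : in_cube (0 : 'rV[R]_d).
Proof. by move=> j; rewrite mxE oppr_lt0 pi_gt0 pi_ge0. Qed.

(** * Fejer kernel *)

(** The sides of a box vary with the coordinate, so its points are dependent functions. Passing to
    tagged values reduces the claim to ordinary distributivity. *)
Lemma bigA_distr_dffun (R : comPzSemiRingType) (I : finType) (T_ : I -> finType)
    (F : forall i, T_ i -> R) :
  \prod_i \sum_(t : T_ i) F i t =
  \sum_(w : {dffun forall i, T_ i}) \prod_i F i (w i).
Proof.
under eq_bigr do rewrite (big_tag F).
rewrite bigA_distr_big_dep (reindex _ (onW_bij _ (dffun_of_fprod_bij T_))).
transitivity (\sum_(t : fprod T_) \prod_(i in I) [ffun x => F i x] (t i)).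
  rewrite (@big_fprod _ _ 1 _ _ I T_ (fun i => [ffun x => F i x])).
  apply: eq_bigr => g _; apply: eq_bigr => i _; congr untag.
  by apply/funext => x; rewrite ffunE.
by apply: eq_bigr => t _; apply: eq_bigr => i _; rewrite !ffunE.
Qed.

Section ComplexExponential.
Context {R : realType}.
Implicit Types (x y : R) (z : R[i]).

Lemma Re_sum (I : Type) (r : seq I) (F : I -> R[i]) :
  complex.Re (\sum_(i <- r) F i) = \sum_(i <- r) complex.Re (F i).
Proof. by apply: (big_morph (@complex.Re R)) => // -[? ?] [? ?]. Qed.

Lemma expiD x y : expi (x + y) = expi x * expi y.
Proof. by rewrite /expi cosD sinD; congr Complex; rewrite addrC. Qed.

Lemma expi0 : expi 0 = 1 :> R[i].
Proof. by rewrite /expi cos0 sin0. Qed.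

Lemma expi_sum (I : Type) (r : seq I) (F : I -> R) :
  expi (\sum_(i <- r) F i) = \prod_(i <- r) expi (F i).
Proof. by apply: big_morph; [exact: expiD|exact: expi0]. Qed.

Lemma conjc_expi x : conjc (expi x) = expi (- x).
Proof. by rewrite /expi cosN sinN. Qed.

Lemma sqmod_ge0 z : 0 <= sqmod z.
Proof. by rewrite addr_ge0// sqr_ge0. Qed.

Lemma sqmodM z1 z2 : sqmod (z1 * z2) = sqmod z1 * sqmod z2 :> R.
Proof. by case: z1 z2 => [a b] [a' b']; rewrite /sqmod/=; ring. Qed.

Lemma sqmod_prod (I : Type) (r : seq I) (F : I -> R[i]) :
  sqmod (\prod_(i <- r) F i) = \prod_(i <- r) sqmod (F i).
Proof.
apply: big_morph; first exact: sqmodM.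
by rewrite /sqmod/= expr1n expr0n/= addr0.
Qed.

Lemma sqmodE z : sqmod z = complex.Re (z * conjc z).
Proof. by case: z => a b; rewrite /sqmod/=; ring. Qed.

Lemma sqmod_sum (I : finType) (F : I -> R[i]) :
  sqmod (\sum_i F i) = \sum_i \sum_j complex.Re (F i * conjc (F j)).
Proof.
rewrite sqmodE rmorph_sum big_distrlr/= Re_sum.
by apply: eq_bigr => i _; rewrite Re_sum.
Qed.

Lemma sqmod_sum_expi (I : finType) (F : I -> R) :
  sqmod (\sum_i expi (F i)) = \sum_i \sum_j cos (F i - F j).
Proof.
rewrite sqmod_sum; apply: eq_bigr => i _; apply: eq_bigr => j _.
by rewrite conjc_expi -expiD.
Qed.

End ComplexExponential.

Section Fejer.
Context {R : realType}.
Implicit Types (x lam : R) (n : nat).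

Definition fejer n x : R := sqmod (\sum_(k < n) expi (k.+1%:R * x)) / n%:R.

Lemma fejer_ge0 n x : 0 <= fejer n x.
Proof. by rewrite divr_ge0 ?sqmod_ge0. Qed.

Lemma fejerE n x : fejer n x =
  n%:R^-1 * \sum_(k < n) \sum_(l < n) cos ((k%:Z - l%:Z)%:~R * x).
Proof.
rewrite /fejer sqmod_sum_expi mulrC; congr (_ * _).
apply: eq_bigr => k _; apply: eq_bigr => l _; congr cos.
by rewrite -mulrBl -[k.+1]addn1 -[l.+1]addn1 !natrD intrB; congr (_ * _); ring.
Qed.

Lemma continuous_fejer_shift n lam : continuous (fun t => fejer n (t - lam)).
Proof.
under eq_fun do rewrite fejerE.
move=> t; apply: cvgM; first exact: cvg_cst.
apply: continuous_sum => k {}t; apply: continuous_sum => l {}t.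
exact: continuous_cos_affine.
Qed.

(** In the double cosine sum only the [n] diagonal terms have nonzero mean, each equal to [1], and
    the factor [1 / n] normalizes them. *)
Lemma circle_mean_fejer n lam : (0 < n)%N ->
  circle_mean (fun t => fejer n (t - lam)) = 1.
Proof.
move=> n0; under [X in circle_mean X]eq_fun do rewrite fejerE.
have cc (k l : nat) := @continuous_cos_affine R (k%:Z - l%:Z)%:~R lam.
rewrite circle_meanZ; last first.
  by apply: continuous_sum => k t; apply: continuous_sum => l {}t; exact: cc.
rewrite circle_mean_sum; last by move=> k t; apply: continuous_sum => l {}t; exact: cc.
under eq_bigr => k _.
  rewrite circle_mean_sum => [|l]; last exact: cc.
  under eq_bigr => l _.
    rewrite circle_mean_cos subr_eq0.
    over.
  rewrite (bigD1 k)//= eqxx big1 ?addr0.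
    over.
  by move=> l /negbTE lk; rewrite eqz_nat -val_eqE/= eq_sym in lk *; rewrite lk.
by rewrite sumr_const card_ord mulVf// pnatr_eq0 -lt0n.
Qed.

Lemma sum_expi_telescope n x :
  (expi x - 1) * (\sum_(k < n) expi (k.+1%:R * x)) = expi (n.+1%:R * x) - expi x.
Proof.
elim: n => [|n IH]; first by rewrite big_ord0 mulr0 mul1r subrr.
rewrite big_ord_recr/= mulrDr IH mulrBl mul1r -expiD.
rewrite (_ : x + n.+1%:R * x = n.+2%:R * x); first by ring.
by rewrite -[n.+2]addn1 natrD mulrDl mul1r addrC.
Qed.

Lemma sqmod_expiB x y : sqmod (expi x - expi y) = 2 * (1 - cos (x - y)) :> R.
Proof.
rewrite /sqmod/= cosB.
have := cos2Dsin2 x; have := cos2Dsin2 y.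
move: (cos x) (sin x) (cos y) (sin y) => a b c e H1 H2.
transitivity ((a ^+ 2 + b ^+ 2) + (c ^+ 2 + e ^+ 2) - 2 * (a * c + b * e)).
  by ring.
by rewrite H1 H2; ring.
Qed.

(* The Dirichlet sum telescopes after multiplication by [expi x - 1], whose
   squared modulus is [2 * (1 - cos x)]. *)
Lemma fejer_mul_le n x : (0 < n)%N -> fejer n x * (1 - cos x) <= 2 / n%:R.
Proof.
move=> n0; have : sqmod (expi x - 1) * sqmod (\sum_(k < n) expi (k.+1%:R * x)) <= 4.
  rewrite -sqmodM sum_expi_telescope sqmod_expiB.
  by have := cos_geN1 (n.+1%:R * x - x); lra.
rewrite -[X in sqmod (_ - X)]expi0 sqmod_expiB subr0 => le4.
rewrite /fejer mulrAC ler_pM2r ?invr_gt0 ?ltr0n//.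
by move: (sqmod _) (cos x) le4 => a c; lra.
Qed.

End Fejer.

(** A character of the lattice is a product of one-dimensional characters, which is why the kernel
    of a box is a product of Fejer kernels. *)
Lemma sum_box_expi (R : realType) (d : nat) (v : 'I_d -> nat) (lam : 'rV[R]_d) :
  \sum_(w : {dffun forall j : 'I_d, 'I_(v j)}) expi (dotZ (box_pt w) lam) =
  \prod_j \sum_(k < v j) expi (k.+1%:R * lam ord0 j).
Proof.
rewrite bigA_distr_dffun; apply: eq_bigr => w _; rewrite /dotZ expi_sum.
by apply: eq_bigr => j _; rewrite ffunE.
Qed.

(** * Expectation of the periodogram *)

Section LatticeDot.
Context {R : realType} {d : nat}.
Implicit Types (k l : Zd d) (th lam : 'rV[R]_d).

Lemma dotZBl k l th : dotZ (k - l) th = dotZ k th - dotZ l th.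
Proof.
rewrite /dotZ -sumrB; apply: eq_bigr => j _.
by rewrite !ffunE intrB mulrBl.
Qed.

Lemma dotZBr k th lam : dotZ k (th - lam) = dotZ k th - dotZ k lam.
Proof.
rewrite /dotZ -sumrB; apply: eq_bigr => j _.
by rewrite !mxE mulrBr.
Qed.

Lemma continuous_dotZ k : continuous (dotZ k : 'rV[R]_d -> R).
Proof.
apply: continuous_sum => j; apply: continuous_funM; first exact: cst_continuous.
by move=> th; exact: coord_continuous.
Qed.

Lemma continuous_cos_dotZ k : continuous (fun th : 'rV[R]_d => cos (dotZ k th)).
Proof.
by move=> th; apply: continuous_comp; [exact: continuous_dotZ|exact: continuous_cos].
Qed.

Lemma continuous_sin_dotZ k : continuous (fun th : 'rV[R]_d => sin (dotZ k th)).
Proof.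
by move=> th; apply: continuous_comp; [exact: continuous_dotZ|exact: continuous_sin].
Qed.

(** This double sum over the box is what the expected periodogram produces once the covariances are
    replaced by their spectral integrals. *)
Lemma prod_fejerE (v : 'I_d -> nat) (lam : 'rV[R]_d) :
  \prod_j fejer (v j) (lam ord0 j) =
  (\prod_j v j)%:R^-1 *
  \sum_(w : {dffun forall j : 'I_d, 'I_(v j)})
   \sum_(w' : {dffun forall j : 'I_d, 'I_(v j)})
     cos (dotZ (box_pt w - box_pt w') lam).
Proof.
rewrite /fejer big_split/= -sqmod_prod -sum_box_expi sqmod_sum_expi.
rewrite natr_prod -prodfV mulrC; congr (_ * _).
by apply: eq_bigr => w _; apply: eq_bigr => w' _; rewrite dotZBl.
Qed.

End LatticeDot.

Section MeanPeriodogram.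
Context {R : realType} {dT : measure_display} {T : measurableType dT}
  (P : probability T R).

Lemma ExE (f : T -> R) : Ex P f = Rintegral P setT f.
Proof. by rewrite /Ex unlock. Qed.

Lemma L2_integrable_mul (f g : T -> R) : L2 P f -> L2 P g ->
  P.-integrable setT (EFin \o (fun w => f w * g w)).
Proof.
move=> [mf if2] [mg ig2].
apply: (@le_integrable _ _ _ P setT _ _
  (fun w => ((f w ^+ 2)%:E + (g w ^+ 2)%:E)%E)) => //.
- by apply/measurable_EFinP; exact: measurable_funM.
- move=> w _ /=; rewrite lee_fin [leRHS]ger0_norm; last by rewrite addr_ge0 ?sqr_ge0.
  rewrite normrM -[f w ^+ 2]real_normK ?num_real// -[g w ^+ 2]real_normK ?num_real//.
  (* The domination [|f g| <= f^2 + g^2] follows from this square. *)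
  have := sqr_ge0 (`|f w| - `|g w|).
  have := normr_ge0 (f w); have := normr_ge0 (g w).
  by move: `|f w| `|g w| => a b; nra.
- exact: integrableD.
Qed.

Lemma integrable_funZ (r : R) (g : T -> R) : P.-integrable setT (EFin \o g) ->
  P.-integrable setT (EFin \o (fun w => r * g w)).
Proof. exact: (@integrableZl _ _ _ P setT measurableT r (EFin \o g)). Qed.

Context {d : nat} (X : Zd d -> T -> R[i]) (f : 'rV[R]_d -> R).
Hypothesis L2X : forall k,
  L2 P (fun w => complex.Re (X k w)) /\ L2 P (fun w => complex.Im (X k w)).
Hypothesis spX : spectral_density P X f.
Hypothesis cf : continuous f.

Lemma integrable_Re_covar k l :
  P.-integrable setT (EFin \o (fun w => complex.Re (X k w * conjc (X l w)))).
Proof.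
have [rk ik] := L2X k; have [rl il] := L2X l.
apply: (eq_integrable measurableT (fun w =>
   ((complex.Re (X k w) * complex.Re (X l w))%:E +
    (complex.Im (X k w) * complex.Im (X l w))%:E)%E)).
  by move=> w _ /=; case: (X k w) (X l w) => [a b] [a' b'] /=; rewrite mulrN opprK.
by apply: integrableD => //; exact: L2_integrable_mul.
Qed.

Lemma integrable_Im_covar k l :
  P.-integrable setT (EFin \o (fun w => complex.Im (X k w * conjc (X l w)))).
Proof.
have [rk ik] := L2X k; have [rl il] := L2X l.
apply: (eq_integrable measurableT (fun w =>
   ((complex.Im (X k w) * complex.Re (X l w))%:E -
    (complex.Re (X k w) * complex.Im (X l w))%:E)%E)).
  move=> w _ /=; case: (X k w) (X l w) => [a b] [a' b'] /=.
  by rewrite mulrN addrC.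
by apply: integrableB => //; exact: L2_integrable_mul.
Qed.

Lemma Ex_Re_covar k l : Ex P (fun w => complex.Re (X k w * conjc (X l w))) =
  torus_int (fun th => cos (dotZ (k - l) th) * f th).
Proof. by have [_ _ /(_ k l) []] := spX. Qed.

Lemma Ex_Im_covar k l : Ex P (fun w => complex.Im (X k w * conjc (X l w))) =
  torus_int (fun th => sin (dotZ (k - l) th) * f th).
Proof. by have [_ _ /(_ k l) []] := spX. Qed.

(** The [(k, l)] term of [|S|^2] for the rotated field; real parts suffice because the whole double
    sum is real. *)
Definition rotated_covar (lam : 'rV[R]_d) k l w : R :=
  complex.Re (expi (- dotZ k lam) * X k w * conjc (expi (- dotZ l lam) * X l w)).

Lemma rotated_covarE lam k l : rotated_covar lam k l =
  (fun w => cos (dotZ (k - l) lam) * complex.Re (X k w * conjc (X l w)) +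
            sin (dotZ (k - l) lam) * complex.Im (X k w * conjc (X l w))).
Proof.
apply/funext => w; have conjcM (a b : R[i]) : conjc (a * b) = conjc a * conjc b by exact: rmorphM.
rewrite /rotated_covar conjcM mulrACA.
rewrite conjc_expi -expiD opprK.
have -> : - dotZ k lam + dotZ l lam = - dotZ (k - l) lam.
  by rewrite dotZBl opprB addrC.
case: (X k w * _) => a b; rewrite /expi /= cosN sinN; ring.
Qed.

Lemma integrable_rotated_covar lam k l :
  P.-integrable setT (EFin \o rotated_covar lam k l).
Proof.
rewrite rotated_covarE.
apply: (@integrableD _ _ _ P setT measurableT
  (fun w => (cos (dotZ (k - l) lam) * complex.Re (X k w * conjc (X l w)))%:E)
  (fun w => (sin (dotZ (k - l) lam) * complex.Im (X k w * conjc (X l w)))%:E)).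
- by apply: integrable_funZ; exact: integrable_Re_covar.
- by apply: integrable_funZ; exact: integrable_Im_covar.
Qed.

Lemma continuous_cosBf k lam :
  continuous (fun th : 'rV[R]_d => cos (dotZ k (th - lam)) * f th).
Proof.
have cdot : continuous (fun th : 'rV[R]_d => dotZ k (th - lam)).
  under eq_fun do rewrite dotZBr.
  apply: continuous_funD; last exact: cst_continuous.
  exact: continuous_dotZ.
apply: continuous_funM => // th.
by apply: continuous_comp; [exact: cdot|exact: continuous_cos].
Qed.

(** Rotating the field by [lam] translates the frequency: the cosine and sine integrals recombine by
    the formula for the cosine of a difference. *)
Lemma Ex_rotated_covar lam k l : Ex P (rotated_covar lam k l) =
  torus_int (fun th => cos (dotZ (k - l) (th - lam)) * f th).
Proof.
rewrite rotated_covarE ExE RintegralD//; last 2 first.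
- by apply: integrable_funZ; exact: integrable_Re_covar.
- by apply: integrable_funZ; exact: integrable_Im_covar.
rewrite RintegralZl//; last exact: integrable_Re_covar.
rewrite RintegralZl//; last exact: integrable_Im_covar.
rewrite -!ExE Ex_Re_covar Ex_Im_covar !torus_intE.
have cc : continuous (fun th : 'rV[R]_d => cos (dotZ (k - l) th) * f th).
  by apply: continuous_funM => //; exact: continuous_cos_dotZ.
have cs : continuous (fun th : 'rV[R]_d => sin (dotZ (k - l) th) * f th).
  by apply: continuous_funM => //; exact: continuous_sin_dotZ.
rewrite -!torus_meanZ// -torus_meanD.
- congr torus_mean; apply/funext => th; rewrite dotZBr cosB; ring.
- by apply: continuous_funM => //; exact: cst_continuous.
- by apply: continuous_funM => //; exact: cst_continuous.
Qed.

Lemma integrable_funsum (I : finType) (F : I -> T -> R) :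
  (forall i, P.-integrable setT (EFin \o F i)) ->
  P.-integrable setT (EFin \o (fun w => \sum_i F i w)).
Proof.
move=> iF; rewrite (_ : _ \o _ = (fun w => (\sum_i (F i w)%:E)%E)).
  by apply: integrable_sum => // i _; exact: iF.
by apply/funext => w /=; rewrite sumEFin.
Qed.

Lemma Ex_sum_rotated_covar (I : finType) (p : I -> Zd d) (c : R) lam :
  Ex P (fun w => c * \sum_k \sum_l rotated_covar lam (p k) (p l) w) =
  torus_int (fun th =>
    c * \sum_k \sum_l cos (dotZ (p k - p l) (th - lam)) * f th).
Proof.
have isum k : P.-integrable setT
    (EFin \o (fun w => \sum_l rotated_covar lam (p k) (p l) w)).
  by apply: integrable_funsum => l; exact: integrable_rotated_covar.
have csum k : continuous (fun th : 'rV[R]_d =>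
    \sum_l cos (dotZ (p k - p l) (th - lam)) * f th).
  by apply: continuous_sum => l; exact: continuous_cosBf.
rewrite ExE RintegralZl//; last exact: integrable_funsum.
rewrite torus_intE torus_meanZ; last exact: continuous_sum.
congr (_ * _); rewrite Rintegral_sum// torus_mean_sum//.
apply: eq_bigr => k _; rewrite Rintegral_sum//; last first.
  by move=> l; exact: integrable_rotated_covar.
rewrite torus_mean_sum; last by move=> l; exact: continuous_cosBf.
by apply: eq_bigr => l _; rewrite -ExE Ex_rotated_covar.
Qed.

Lemma Ex_periodogram (v : 'I_d -> nat) lam : Ex P (periodogram X v lam) =
  torus_int (fun th => f th * \prod_j fejer (v j) (th ord0 j - lam ord0 j)).
Proof.
transitivity (Ex P (fun w => (\prod_(j < d) v j)%:R^-1 *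
    \sum_(k : {dffun forall j : 'I_d, 'I_(v j)})
    \sum_(l : {dffun forall j : 'I_d, 'I_(v j)})
      rotated_covar lam (box_pt k) (box_pt l) w)).
  by congr Ex; apply/funext => w; rewrite /periodogram /Ssum sqmod_sum mulrC.
rewrite Ex_sum_rotated_covar; congr torus_int; apply/funext => th.
transitivity (f th * \prod_j fejer (v j) ((th - lam) ord0 j)); last first.
  by congr (_ * _); apply: eq_bigr => j _; rewrite !mxE.
rewrite prod_fejerE mulrCA; congr (_ * _).
rewrite mulr_sumr; apply: eq_bigr => k _.
by rewrite mulr_sumr; apply: eq_bigr => l _; rewrite mulrC.
Qed.

End MeanPeriodogram.

(** * Convergence of Fejer means *)

Section FejerMean.
Context {R : realType} {d : nat}.
Variables (v : 'I_d -> nat) (lam : 'rV[R]_d).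
Hypothesis v_gt0 : forall j, (0 < v j)%N.

Local Notation mean g := (torus_mean (enum 'I_d) g 0).

Definition fejer_kernel (th : 'rV[R]_d) : R :=
  \prod_j fejer (v j) (th ord0 j - lam ord0 j).

Lemma fejer_kernel_ge0 th : 0 <= fejer_kernel th.
Proof. by apply: prodr_ge0 => j _; exact: fejer_ge0. Qed.

Lemma continuous_coord_comp (g : R -> R) (j : 'I_d) : continuous g ->
  continuous (fun th : 'rV[R]_d => g (th ord0 j)).
Proof.
by move=> cg th; apply: continuous_comp; [exact: coord_continuous|exact: cg].
Qed.

Lemma continuous_fejer_kernel : continuous fejer_kernel.
Proof.
apply: continuous_prod => j.
apply: (@continuous_coord_comp (fun t => fejer (v j) (t - lam ord0 j)) j).
exact: continuous_fejer_shift.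
Qed.

Lemma mean_fejer_kernel : mean fejer_kernel = 1.
Proof.
rewrite (@torus_mean_prod R d (enum 'I_d) (fun j t => fejer (v j) (t - lam ord0 j)))
  ?enum_uniq//; last by move=> j; exact: continuous_fejer_shift.
by apply: big1 => j _; rewrite mem_enum circle_mean_fejer.
Qed.

(** Korovkin test function: nonnegative, and zero exactly when the [j]-th coordinates agree modulo
    [2 * pi]. *)
Definition one_sub_cos (j : 'I_d) (th : 'rV[R]_d) : R :=
  1 - cos (th ord0 j - lam ord0 j).

Lemma continuous_one_sub_cos j : continuous (one_sub_cos j).
Proof.
apply: (@continuous_coord_comp (fun t => 1 - cos (t - lam ord0 j)) j) => t.
apply: cvgB; first exact: cvg_cst.
under eq_fun do rewrite -[_ - _]mul1r.
have := @continuous_cos_affine R 1 (lam ord0 j) t.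
by rewrite /continuous_at mul1r.
Qed.

Lemma mean_one_sub_cos_kernel j :
  mean (fun th => one_sub_cos j th * fejer_kernel th) <= 2 / (v j)%:R.
Proof.
(* The kernel with its [j]-th factor, multiplied by the test function, replaced by the bound of
   [fejer_mul_le]. The other factors have mean [1]. *)
pose g (i : 'I_d) (t : R) :=
  if i == j then 2 / (v j)%:R else fejer (v i) (t - lam ord0 i).
have cg i : continuous (g i).
  rewrite /g; case: eqP => _; first exact: cst_continuous.
  exact: continuous_fejer_shift.
apply: (@le_trans _ _ (mean (fun th => \prod_i g i (th ord0 i)))).
  apply: le_torus_mean; last exact: in_cube0.
  - apply: continuous_funM; first exact: continuous_one_sub_cos.
    exact: continuous_fejer_kernel.
  - by apply: continuous_prod => i; exact: continuous_coord_comp.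
  move=> th _; rewrite /fejer_kernel (bigD1 j)//= [leRHS](bigD1 j)//= {1}/g eqxx mulrA.
  rewrite (eq_bigr (fun i => g i (th ord0 i))); last first.
    by move=> i ij; rewrite /g (negbTE ij).
  rewrite ler_wpM2r//; last by rewrite mulrC fejer_mul_le.
  apply: prodr_ge0 => i ij.
  by rewrite /g (negbTE ij) fejer_ge0.
rewrite torus_mean_prod ?enum_uniq// (bigD1 j)//= mem_enum/= big1 ?mulr1.
  by rewrite /g eqxx circle_mean_cst.
by move=> i ij; rewrite mem_enum/= /g (negbTE ij) circle_mean_fejer.
Qed.

(** The pointwise bound is multiplied by the nonnegative kernel and averaged. Being one-sided, it
    applies to both [g] and [- g]. *)
Lemma fejer_mean_le (g : 'rV[R]_d -> R) (e C : R) : continuous g -> 0 <= C ->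
  (forall th, in_cube th ->
     g th <= g lam + e + C * \sum_j one_sub_cos j th) ->
  mean (fun th => g th * fejer_kernel th) <=
  g lam + e + C * \sum_j 2 / (v j)%:R.
Proof.
move=> cg C0 gle.
have cK := continuous_fejer_kernel.
have cMK j : continuous (fun th => one_sub_cos j th * fejer_kernel th).
  by apply: continuous_funM => //; exact: continuous_one_sub_cos.
have cZ (a : R) (h : 'rV[R]_d -> R) : continuous h -> continuous (fun th => a * h th).
  by move=> ch; apply: continuous_funM => //; exact: cst_continuous.
have csum : continuous (fun th => \sum_j one_sub_cos j th * fejer_kernel th).
  exact: continuous_sum.
apply: (@le_trans _ _ (mean (fun th => (g lam + e) * fejer_kernel th +
    C * \sum_j one_sub_cos j th * fejer_kernel th))).
  apply: le_torus_mean; last exact: in_cube0.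
  - exact: continuous_funM.
  - by apply: continuous_funD; exact: cZ.
  move=> th cth; rewrite -mulr_suml mulrA -mulrDl.
  by rewrite ler_wpM2r ?fejer_kernel_ge0// gle.
rewrite torus_meanD; [|exact: cZ|exact: cZ].
rewrite !torus_meanZ// mean_fejer_kernel mulr1 lerD2l ler_wpM2l//.
rewrite torus_mean_sum//.
by apply: ler_sum => j _; exact: mean_one_sub_cos_kernel.
Qed.

End FejerMean.

Lemma fejer_mean_near (R : realType) (d : nat) (v : 'I_d -> nat)
    (lam : 'rV[R]_d) (g : 'rV[R]_d -> R) (e C : R) :
  (forall j, (0 < v j)%N) -> continuous g -> 0 <= C ->
  (forall th, in_cube th ->
     `|g th - g lam| <= e + C * \sum_j one_sub_cos lam j th) ->
  `|torus_int (fun th => g th * fejer_kernel v lam th) - g lam| <=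
  e + C * \sum_j 2 / (v j)%:R.
Proof.
move=> v0 cg C0 gle; rewrite torus_intE ler_distl; apply/andP; split; last first.
  rewrite addrA; apply: fejer_mean_le => // th /gle.
  by rewrite ler_distl => /andP[_]; rewrite addrA.
(* The lower bound is the upper bound for [- g]. *)
have cN : continuous (fun th : 'rV[R]_d => - g th).
  under eq_fun do rewrite -mulN1r.
  by apply: continuous_funM => //; exact: cst_continuous.
have cgK : continuous (fun th => g th * fejer_kernel v lam th).
  by apply: continuous_funM => //; exact: continuous_fejer_kernel.
have := @fejer_mean_le R d v lam v0 (fun th => - g th) e C cN C0.
have -> : torus_mean (enum 'I_d) (fun th => - g th * fejer_kernel v lam th) 0 =
    - torus_mean (enum 'I_d) (fun th => g th * fejer_kernel v lam th) 0.
  rewrite -mulN1r -torus_meanZ//; congr torus_mean.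
  by apply/funext => th; rewrite mulN1r mulNr.
move: (torus_mean _ _ _) => A H.
have {}H : - A <= - g lam + e + C * \sum_j 2 / (v j)%:R.
  apply: H => th /gle; rewrite ler_distl => /andP[+ _].
  by move: (_ * \sum_j _) => B; lra.
by move: H; move: (_ * \sum_j _) => B; lra.
Qed.

(** * Modulus of continuity of a periodic function *)

Section PeriodicModulus.
Context {R : realType} {d : nat} (f : 'rV[R]_d -> R).
Hypothesis f_periodic : forall th (j : 'I_d), f (upd th j (th ord0 j + 2 * pi)) = f th.
Hypothesis cf : continuous f.

Lemma upd_id (th : 'rV[R]_d) j : upd th j (th ord0 j) = th.
Proof. by apply/rowP => i; rewrite mxE; case: eqP => [->|]. Qed.

Lemma upd_upd (th : 'rV[R]_d) j s t : upd (upd th j s) j t = upd th j t.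
Proof. by apply/rowP => i; rewrite !mxE; case: eqP. Qed.

(** The list holds the only multiples of [2 * pi] that can separate two points of [[- pi, pi]]. *)
Lemma periodic_upd (th : 'rV[R]_d) j t :
  t - th ord0 j \in [:: 0; 2 * pi; - (2 * pi)] -> f (upd th j t) = f th.
Proof.
rewrite !inE => /or3P[] /eqP tth.
- by rewrite (_ : t = th ord0 j) ?upd_id//; apply/eqP; rewrite -subr_eq0 tth.
- by rewrite -(f_periodic th j) -tth addrC subrK.
- rewrite -(f_periodic (upd th j t) j) upd_upd mxE eqxx.
  by rewrite (_ : t + 2 * pi = th ord0 j) ?upd_id//; lra.
Qed.

Lemma periodic_eq (th lam : 'rV[R]_d) :
  (forall j, th ord0 j - lam ord0 j \in [:: 0; 2 * pi; - (2 * pi)]) ->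
  f th = f lam.
Proof.
move=> thlam.
(* The points [mix s] lead from [lam] to [th] by changing one coordinate at a time; an index already
   treated gives the difference [0]. *)
pose mix (s : seq 'I_d) : 'rV[R]_d :=
  \row_i (if i \in s then th ord0 i else lam ord0 i).
have mixE s : f (mix s) = f lam.
  elim: s => [|a s IH]; first by congr f; apply/rowP => i; rewrite mxE.
  rewrite -IH (_ : mix (a :: s) = upd (mix s) a (th ord0 a)); last first.
    by apply/rowP => i; rewrite !mxE inE; case: eqP => [->|].
  apply: periodic_upd; rewrite mxE; case: ifP => _ //.
  by rewrite subrr inE eqxx.
rewrite -(mixE (enum 'I_d)); congr f; apply/rowP => i.
by rewrite mxE mem_enum.
Qed.

(** Cosine is injective on [[0, pi]]; when [|x|] exceeds [pi], the reflected point [2 * pi - |x|]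
    falls in that interval. *)
Lemma cos_eq1_2pi (x : R) : `|x| <= 2 * pi -> cos x = 1 ->
  x \in [:: 0; 2 * pi; - (2 * pi)].
Proof.
move=> x2pi cosx.
have arc y : 0 <= y <= pi -> cos y = 1 -> y = 0 :> R.
  move=> y0pi cosy; apply: cos_inj; rewrite ?in_itv/= ?lexx ?pi_ge0// cosy cos0//.
rewrite -cos_norm in cosx.
have [xpi|/ltW xpi] := leP `|x| pi.
  by have /eqP := arc _ (introT andP (conj (normr_ge0 x) xpi)) cosx;
     rewrite normr_eq0 !inE => ->.
have : 2 * pi - `|x| = 0.
  apply: arc; first by apply/andP; split; lra.
  have := cos_periodic_int 1 (- `|x|).
  by rewrite mul1r cosN cosx addrC.
move/eqP; rewrite subr_eq0 eq_sym => /eqP xE.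
have [x0|x0] := leP 0 x; move: xE; [rewrite ger0_norm//|rewrite ltr0_norm//] => xE.
  by rewrite !inE xE eqxx orbT.
by rewrite !inE -xE opprK eqxx !orbT.
Qed.

(** The half-open cube is not compact. Its closure is, but contains distinct points that agree
    modulo [2 * pi], which periodicity of [f] handles. *)
Definition closed_cube : set 'rV[R]_d :=
  [set th | forall j, `[- pi, pi]%classic (th ord0 j)].

Lemma compact_closed_cube : compact closed_cube.
Proof.
apply: (@rV_compact R d (fun=> `[- pi, pi]%classic)) => j.
exact: segment_compact.
Qed.

Lemma in_cube_closed (th : 'rV[R]_d) : in_cube th -> closed_cube th.
Proof. by move=> cth j; have /andP[/ltW a b] := cth j; rewrite /= in_itv/= a b. Qed.

Lemma periodic_modulus (e : R) : 0 < e -> exists2 C : R, 0 <= C &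
  forall th lam, in_cube th -> in_cube lam ->
  `|f th - f lam| <= e + C * \sum_j one_sub_cos lam j th.
Proof.
move=> e0.
pose h (p : 'rV[R]_d * 'rV[R]_d) := f p.1 - f p.2.
pose S (p : 'rV[R]_d * 'rV[R]_d) := \sum_j one_sub_cos p.2 j p.1.
have c1 (g : 'rV[R]_d -> R) : continuous g ->
    continuous (fun p : 'rV[R]_d * 'rV[R]_d => g p.1).
  by move=> cg p; apply: continuous_comp; [exact: cvg_fst|exact: cg].
have c2 (g : 'rV[R]_d -> R) : continuous g ->
    continuous (fun p : 'rV[R]_d * 'rV[R]_d => g p.2).
  by move=> cg p; apply: continuous_comp; [exact: cvg_snd|exact: cg].
have cB (g k : 'rV[R]_d * 'rV[R]_d -> R) : continuous g -> continuous k ->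
    continuous (fun p => g p - k p).
  by move=> cg ck p; apply: cvgB; [exact: cg|exact: ck].
have ch : continuous h by apply: cB; [exact: c1|exact: c2].
have ccoord (j : 'I_d) : continuous (fun th : 'rV[R]_d => th ord0 j).
  by move=> th; exact: coord_continuous.
have cS : continuous S.
  apply: continuous_sum => j; apply: (cB); first exact: cst_continuous.
  have cd : continuous (fun p : 'rV[R]_d * 'rV[R]_d => p.1 ord0 j - p.2 ord0 j).
    by apply: cB; [exact: (c1 _ (ccoord j))|exact: (c2 _ (ccoord j))].
  by move=> p; apply: continuous_comp; [exact: cd|exact: continuous_cos].
have one_sub_cos_ge0 p j : 0 <= one_sub_cos p.2 j p.1 :> R.
  by rewrite subr_ge0 cos_le1.
have S_ge0 p : 0 <= S p by apply: sumr_ge0.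
have /compact_near_coveringP cover : compact (closed_cube `*` closed_cube).
  by apply: compact_setX; exact: compact_closed_cube.
(* Compactness is used on pairs [(th, lam)] with the filter at infinity: if near each pair all large
   [n] work, then one [n] works for all pairs. That [n] is [C], independent of [lam]. *)
have := cover nat \oo (fun n p => `|h p| <= e + n%:R * S p) _.
(* If the sum [S p] vanishes, the two points agree modulo [2 * pi] and
   continuity of [f] suffices; otherwise [S] is bounded below near [p] and a
   large multiple of it dominates [h]. *)
have prem p : (closed_cube `*` closed_cube) p ->
    \forall p' \near p & n \near \oo, `|h p'| <= e + n%:R * S p'.
  move=> [c_th c_lam].
  have [S0|S0] := eqVneq (S p) 0.
    have hp0 : h p = 0.
      apply/eqP; rewrite subr_eq0; apply/eqP; apply: periodic_eq => j.
      apply: cos_eq1_2pi.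
        have := c_th j; have := c_lam j; rewrite /= !in_itv/=.
        move=> /andP[a1 a2] /andP[b1 b2]; rewrite ler_norml.
        by apply/andP; split; lra.
      have /eqP := S0; rewrite psumr_eq0// => /allP/(_ j).
      by rewrite mem_index_enum subr_eq0 => /(_ isT) /eqP <-.
    exists ([set p' | `|h p - h p'| < e], setT) => /=.
      by split; [exact: (continuous_near p ch e0)|exact: filterT].
    move=> [p' n] /= [+ _]; rewrite hp0 sub0r normrN => /ltW hp'.
    by rewrite (le_trans hp')// lerDl mulr_ge0.
  have Sp : 0 < S p by rewrite lt_neqAle eq_sym S0 S_ge0.
  (* Near [p], [|h|] is at most [|h p| + 1] and [S] is at least [S p / 2], so any [n >= N] gives
     [|h| <= n * S]. *)
  pose N := Num.bound ((`|h p| + 1) / (S p / 2)).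
  exists ([set p' | `|h p - h p'| < 1 /\ `|S p - S p'| < S p / 2],
          [set n | (N <= n)%N]) => /=.
    split; last by exists N.
    apply: filterI; first exact: (continuous_near p ch ltr01).
    by apply: (continuous_near p cS); rewrite divr_gt0.
  move=> [p' n] /= [[hp' Sp'] Nn].
  have Sp'_gt : S p / 2 <= S p'.
    by move: Sp'; rewrite ltr_distl => /andP[]; lra.
  have hp'_le : `|h p'| <= `|h p| + 1.
    rewrite -[h p'](subKr (h p)) (le_trans (ler_normB _ _))// lerD2l ltW//.
  rewrite (le_trans hp'_le)// (@le_trans _ _ (n%:R * S p'))//; last first.
    by rewrite lerDr ltW.
  rewrite (@le_trans _ _ (n%:R * (S p / 2)))//; last by rewrite ler_wpM2l.
  rewrite -ler_pdivrMr ?divr_gt0// ltW// (lt_le_trans (archi_boundP _))//.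
    by rewrite divr_ge0 ?addr_ge0// divr_ge0.
  by rewrite ler_nat.
move=> /(_ _ prem) [N _ HN].
exists N%:R => // th lam c_th c_lam.
apply: (HN N (leqnn N) (th, lam)).
by split; exact: in_cube_closed.
Qed.

End PeriodicModulus.

(** * Uniform convergence of the expected periodogram *)

Theorem theorem2p1 (R : realType) (dT : measure_display)
  (T : measurableType dT) (P : probability T R) (d : nat)
  (X : Zd d -> T -> R[i]) (f : 'rV[R]_d -> R) (v : nat -> 'I_d -> nat) :
  (0 < d)%N ->
  centered_weakly_stationary P X ->
  rho' P X n @[n --> \oo] --> 0 ->
  spectral_density P X f ->
  continuous f ->
  (forall n j, (0 < v n j)%N) ->
  (forall M : nat, exists N : nat, forall n, (N <= n)%N ->
     forall j : 'I_d, (M <= v n j)%N) ->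
  (forall lam : 'rV[R]_d, in_cube lam ->
     Ex P (periodogram X (v n) lam) @[n --> \oo] --> f lam) /\
  (forall e : R, 0 < e -> exists N : nat, forall n, (N <= n)%N ->
     forall lam : 'rV[R]_d, in_cube lam ->
       `|Ex P (periodogram X (v n) lam) - f lam| < e).
Proof.
move=> _ [L2X _ _ _] _ spX cf v_gt0 v_large.
have [_ f_periodic _] := spX.
have unif (e : R) : 0 < e -> exists N : nat, forall n, (N <= n)%N ->
     forall lam : 'rV[R]_d, in_cube lam ->
       `|Ex P (periodogram X (v n) lam) - f lam| < e.
  move=> e0; have e20 : 0 < e / 2 by rewrite divr_gt0.
  have [C C0 modC] := periodic_modulus f_periodic cf e20.
  (* With all sides at least [M], the error [C * sum_j 2 / v_j] is at most [2 * C * d / M], which is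
     below [e / 2] once [M > 4 * C * d / e]. The successor makes [M] positive. *)
  pose M := (Num.bound (C * d%:R * 4 / e)).+1.
  have [N v_geM] := v_large M.
  exists N => n Nn lam c_lam; rewrite (Ex_periodogram L2X spX cf).
  have near_lam : `|torus_int (fun th => f th * fejer_kernel (v n) lam th) - f lam| <=
      e / 2 + C * \sum_j 2 / (v n j)%:R.
    by apply: fejer_mean_near => // th c_th; exact: modC.
  rewrite (le_lt_trans near_lam)// [ltRHS]splitr ltrD2l.
  have M_gt0 : 0 < M%:R :> R by rewrite ltr0n.
  have sum_le : \sum_j 2 / (v n j)%:R <= d%:R * (2 / M%:R) :> R.
    have <- : \sum_(j < d) 2 / M%:R = d%:R * (2 / M%:R) :> R.
      by rewrite sumr_const card_ord [RHS]mulr_natl.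
    apply: ler_sum => j _; rewrite ler_pM2l// lef_pV2 ?posrE ?ltr0n// ler_nat.
    exact: v_geM.
  have : C * d%:R * 4 / e < M%:R.
    rewrite (lt_trans (archi_boundP _)) ?ltr_nat//.
    by rewrite divr_ge0 ?(ltW e0)// !mulr_ge0.
  rewrite ltr_pdivrMr// => CM.
  rewrite (le_lt_trans (ler_wpM2l C0 sum_le))//.
  rewrite !mulrA ltr_pdivrMr//.
  by move: CM; move: (C * d%:R) (M%:R : R) => a b; nra.
(* Pointwise convergence is read off from the uniform estimate. *)
split=> // lam c_lam; apply/cvgrPdist_lt => e e0.
have [N HN] := unif e e0; exists N => // n /= Nn.
by rewrite distrC; exact: HN.
Qed.
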